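(* Consider the environment with two pure worldviews $J=\{1,2\}$, actions $X=\{c,a,b\}$ and payoffs $u_1(c)=0,\ u_1(a)=1,\ u_1(b)=-3$, $u_2(c)=0,\ u_2(a)=-3,\ u_2(b)=1$, where a worldview is identified with the weight $\alpha\in[0,1]$ on worldview 1. For every $\delta\in(0,1)$ and $\lambda\in(0,1)$ this environment admits a stationary MPE. From the initial worldview $\alpha_0=1/2$, the following hold for the induced path $(\alpha_t,x_t)_{t\ge0}$: (i) If $0<\lambda<1/2$, then in every stationary MPE, $\alpha_1\in\{0,1\}$ and $\alpha_t=\alpha_1$ for all $t\ge1$. (ii) If $\lambda=1/2$, there exists a stationary MPE whose path from $\alpha_0=1/2$ converges to a pure worldview, and there exists a stationary MPE whose path from $\alpha_0=1/2$ does not converge to a pure worldview. In every stationary MPE, for every $t\ge1$, $$(\alpha_t,x_t)\in\{(\beta,c):\beta\in[1/4,3/4]\}\cup\{(1,a),(0,b)\}.$$ (iii) If $1/2<\lambda<1$, then in every stationary MPE, $x_t=c$ and $\alpha_t\in[1/4,3/4]$ for all $t\ge0$. In particular $\operatorname{dist}(\alpha_t,\{0,1\})\ge 1/4$ for all $t$ (usual distance on $[0,1]$), so the path does not converge to the set of pure worldviews.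
   Context: For $\alpha\in[0,1]$ and $x\in X$ put $U(\alpha,x)=\alpha u_1(x)+(1-\alpha)u_2(x)$ and $z^*(\alpha)=\arg\max_{x\in X}U(\alpha,x)$. The pure worldviews are $0$ and $1$. Fix $0<\delta<1$ and $0<\lambda<1$. A stationary pure strategy is a pair of arbitrary maps $\phi:[0,1]\to[0,1]$, $z:[0,1]\to X$ (no continuity or measurability assumed). With $\phi^k$ the $k$-fold iterate, put $$C_{\phi,z}(\beta;\alpha)=\sum_{k=0}^\infty\delta^k\big[(1-\lambda)U(\phi^k(\beta),z(\phi^k(\beta)))+\lambda U(\alpha,z(\phi^k(\beta)))\big].$$ A stationary MPE (Markov-perfect equilibrium) is a pair $(\phi,z)$ such that for every $\alpha\in[0,1]$: $z(\alpha)\in z^*(\alpha)$, and $C_{\phi,z}(\phi(\alpha);\alpha)\ge C_{\phi,z}(\beta;\alpha)$ for every $\beta\in[0,1]$. The induced path from $\alpha_0$ is $\alpha_{t+1}=\phi(\alpha_t)$, $x_t=z(\alpha_t)$. *)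

(* Defs.v *)
From HB Require Import structures.
From mathcomp Require Import all_boot all_order all_algebra.
From mathcomp Require Import all_classical all_reals all_analysis.

Set Implicit Arguments.
Unset Strict Implicit.
Unset Printing Implicit Defensive.

Import Order.TTheory GRing.Theory Num.Theory.
Import numFieldNormedType.Exports.

Local Open Scope classical_set_scope.
Local Open Scope ring_scope.

Section Model.
Variables (R : realType) (X : Type).

(* A worldview is identified with its weight on [u1], so it ranges over the
   type {i01 R} of the points of [0, 1]. *)
Definition payoff (u1 u2 : X -> R) (alpha : {i01 R}) (x : X) : R :=
  alpha%:num * u1 x + (1 - alpha%:num) * u2 x.

Definition opt_actions (u1 u2 : X -> R) (alpha : {i01 R}) : set X :=
  [set x | forall y, payoff u1 u2 alpha y <= payoff u1 u2 alpha x].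

(* [limn] is total; for bounded payoffs and 0 < delta < 1 the series converges
   (geometric domination), so this is its genuine sum. *)
Definition continuation (u1 u2 : X -> R) (delta lambda : R)
    (phi : {i01 R} -> {i01 R}) (z : {i01 R} -> X)
    (beta alpha : {i01 R}) : R :=
  limn (series (fun k =>
    let b := iter k phi beta in
    delta ^+ k * ((1 - lambda) * payoff u1 u2 b (z b)
                  + lambda * payoff u1 u2 alpha (z b)))).

Definition stationary_MPE (u1 u2 : X -> R) (delta lambda : R)
    (phi : {i01 R} -> {i01 R}) (z : {i01 R} -> X) : Prop :=
  forall alpha : {i01 R},
    opt_actions u1 u2 alpha (z alpha) /\
    forall beta : {i01 R},
      continuation u1 u2 delta lambda phi z beta alpha <=
      continuation u1 u2 delta lambda phi z (phi alpha) alpha.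

Definition worldview_path (phi : {i01 R} -> {i01 R}) (alpha0 : {i01 R})
    (t : nat) : {i01 R} :=
  iter t phi alpha0.

Definition action_path (phi : {i01 R} -> {i01 R}) (z : {i01 R} -> X)
    (alpha0 : {i01 R}) (t : nat) : X :=
  z (worldview_path phi alpha0 t).

Definition pure_worldviews : set {i01 R} := [set 0%:i01; 1%:i01].

Definition converges_to_pure (a : nat -> {i01 R}) : Prop :=
  exists2 p, pure_worldviews p & (a t)%:num @[t --> \oo] --> p%:num.

Definition dist_set (A : set {i01 R}) (x : {i01 R}) : R :=
  inf [set `|x%:num - y%:num| | y in A].

End Model.

Arguments pure_worldviews {R}.

Inductive action := act_c | act_a | act_b.

Definition pay1 (R : realType) (x : action) : R :=
  match x with act_c => 0 | act_a => 1 | act_b => -3 end.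

Definition pay2 (R : realType) (x : action) : R :=
  match x with act_c => 0 | act_a => -3 | act_b => 1 end.

Definition is_MPE (R : realType) (delta lambda : R)
    (phi : {i01 R} -> {i01 R}) (z : {i01 R} -> action) : Prop :=
  stationary_MPE (@pay1 R) (@pay2 R) delta lambda phi z.

Lemma half_ge0 (R : realType) : 0 <= 1 / 2 :> R.
Proof. by rewrite divr_ge0. Qed.

Lemma half_le1 (R : realType) : 1 / 2 <= 1 :> R.
Proof. by rewrite ler_pdivrMr// mul1r ler1n. Qed.

Definition mid_worldview (R : realType) : {i01 R} := Itv01 (half_ge0 R) (half_le1 R).

(* Main.v *)
(* Fix the current worldview alpha and let M bound the per-period payoff. The
   total M / (1 - delta) can be secured as soon as M is attained at an absorbing
   worldview, or at alpha itself (one step, then the equilibrium continuation),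
   so the equilibrium choice achieves M / (1 - delta), which forces every period
   to yield exactly M. At alpha = 1 and alpha = 0 this makes the pure worldviews
   absorbing in every equilibrium; at alpha = 1/2 the maximal payoff is
   max(1 - 2 lambda, 0), attained only at the pure worldviews if lambda < 1/2
   and only with action c if lambda > 1/2. An equilibrium is obtained by jumping
   to the best of the worldviews 0, 1/2, 1. *)
Require Import Defs.
From HB Require Import structures.
From mathcomp Require Import all_boot all_order all_algebra.
From mathcomp Require Import all_classical all_reals all_analysis.
From mathcomp Require Import ring lra.

Set Implicit Arguments.
Unset Strict Implicit.
Unset Printing Implicit Defensive.

Import Order.TTheory GRing.Theory Num.Theory.
Import numFieldNormedType.Exports.

Local Open Scope classical_set_scope.
Local Open Scope ring_scope.

(** * Discounted sums of bounded sequences *)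

Definition discounted (R : realType) (delta : R) (u : nat -> R) : R :=
  limn (series (fun k => delta ^+ k * u k)).

Lemma is_cvg_discounted (R : realType) (delta B : R) (u : nat -> R) :
  0 < delta < 1 -> (forall k, `|u k| <= B) ->
  cvgn (series (fun k => delta ^+ k * u k)).
Proof.
move=> /andP[d0 d1] uB; apply: normed_cvg.
apply: (@series_le_cvg _ _ (geometric B delta)) => [n|n|n|].
- exact: normr_ge0.
- by rewrite /geometric /= mulr_ge0 ?exprn_ge0 ?(ltW d0)// (le_trans _ (uB 0%N)).
- rewrite /geometric /= normrM ger0_norm ?exprn_ge0 ?(ltW d0)// mulrC.
  by rewrite ler_wpM2r ?exprn_ge0 ?(ltW d0).
- by apply: is_cvg_geometric_series; rewrite gtr0_norm.
Qed.

Lemma discounted_cst (R : realType) (delta M : R) : 0 < delta < 1 ->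
  discounted delta (fun=> M) = M / (1 - delta).
Proof.
move=> /andP[d0 d1]; apply/cvg_lim => //.
have -> : (fun k => delta ^+ k * M) = geometric M delta.
  by apply/funext => k; rewrite /geometric /= mulrC.
by apply: cvg_geometric_series; rewrite gtr0_norm.
Qed.

Lemma discounted_le (R : realType) (delta B M : R) (u : nat -> R) :
  0 < delta < 1 -> (forall k, `|u k| <= B) -> (forall k, u k <= M) ->
  discounted delta u <= M / (1 - delta).
Proof.
move=> hd uB uM; rewrite -(discounted_cst M hd).
have d0 : 0 <= delta by case/andP: hd => /ltW.
apply: ler_lim.
- exact: is_cvg_discounted uB.
- by apply: (@is_cvg_discounted _ _ `|M|).
- apply: nearW => n; apply: ler_sum => k _.
  by rewrite ler_wpM2l ?exprn_ge0.
Qed.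

Lemma discounted_recl (R : realType) (delta B : R) (u : nat -> R) :
  0 < delta < 1 -> (forall k, `|u k| <= B) ->
  discounted delta u = u 0%N + delta * discounted delta (fun k => u k.+1).
Proof.
move=> hd uB; pose s := series (fun k => delta ^+ k * u k).
have /cvg_ex[l sl] := is_cvg_discounted hd uB.
have sS : (fun n => s n.+1) @ \oo --> l by rewrite (cvg_shiftS s).
rewrite /discounted (cvg_lim _ sl)//.
apply: (cvg_unique _ sS); first exact: Rhausdorff.
have -> : (fun n => s n.+1) = (fun n => u 0%N +
    delta * series (fun k => delta ^+ k * u k.+1) n).
  apply/funext => n; rewrite /s /series /= big_nat_recl// expr0 mul1r.
  rewrite big_distrr/=; congr (_ + _).
  by apply: eq_bigr => k _; rewrite exprS mulrA.
apply: cvgD; first exact: cvg_cst.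
apply: cvgM; first exact: cvg_cst.
exact: is_cvg_discounted (fun k => uB k.+1).
Qed.

(** The first term is at most [M] and the discounted tail at most [M / (1 - delta)]. A total that
    reaches the bound makes both equalities, so the tail satisfies the same hypothesis and induction
    applies. *)
Lemma discounted_max (R : realType) (delta B M : R) (u : nat -> R) :
  0 < delta < 1 -> (forall k, `|u k| <= B) -> (forall k, u k <= M) ->
  M / (1 - delta) <= discounted delta u -> forall k, u k = M.
Proof.
move=> hd; have /andP[d0] := hd; rewrite -subr_gt0 => d1.
(* The bound is the fixed point of the recursion for [discounted]. *)
have eM : M / (1 - delta) = M + delta * (M / (1 - delta)).
  by have := lt0r_neq0 d1 => ?; field.
have step v : (forall k, `|v k| <= B) -> (forall k, v k <= M) ->
    M / (1 - delta) <= discounted delta v ->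
    v 0%N = M /\ M / (1 - delta) <= discounted delta (fun k => v k.+1).
  move=> vB vM; rewrite (discounted_recl hd vB).
  have := discounted_le hd (fun k => vB k.+1) (fun k => vM k.+1).
  move: eM (vM 0%N); move: (M / (1 - delta)) => m eM v0M tM hM.
  split; first by apply/le_anti; rewrite v0M /=; nra.
  by rewrite -(ler_pM2l d0); lra.
move=> uB uM hM k; elim: k u uB uM hM => [|k IH] u uB uM.
  by move=> /(step _ uB uM)[].
move=> /(step _ uB uM)[_]; apply: (IH (fun k => u k.+1)) => j.
- exact: uB.
- exact: uM.
Qed.

(** * Stage payoffs and equilibria in a general environment *)

(** The undiscounted summand of [continuation]: it depends on the path only through the worldview
    [beta] held in that period. *)
Definition stage (R : realType) (X : Type) (u1 u2 : X -> R) (lambda : R)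
    (z : {i01 R} -> X) (alpha beta : {i01 R}) : R :=
  (1 - lambda) * payoff u1 u2 beta (z beta) + lambda * payoff u1 u2 alpha (z beta).

Lemma stage_bounded (R : realType) (X : Type) (u1 u2 : X -> R) (lambda B : R)
    (z : {i01 R} -> X) (alpha beta : {i01 R}) :
  0 < lambda < 1 -> (forall x, `|u1 x| <= B) -> (forall x, `|u2 x| <= B) ->
  `|stage u1 u2 lambda z alpha beta| <= B.
Proof.
move=> /andP[l0 l1] B1 B2.
have cvx (t p q : R) : 0 <= t <= 1 -> `|p| <= B -> `|q| <= B ->
    `|t * p + (1 - t) * q| <= B.
  by rewrite !ler_norml => /andP[? ?] /andP[? ?] /andP[? ?]; apply/andP; split; nra.
have i01 (a : {i01 R}) : 0 <= a%:num <= 1 by apply/andP; split.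
have PB (a : {i01 R}) x : `|payoff u1 u2 a x| <= B by apply: cvx.
by rewrite /stage addrC; apply: cvx => //; rewrite !ltW.
Qed.

Lemma continuationE (R : realType) (X : Type) (u1 u2 : X -> R)
    (delta lambda : R) phi z beta alpha :
  continuation u1 u2 delta lambda phi z beta alpha =
  discounted delta (fun k => stage u1 u2 lambda z alpha (iter k phi beta)).
Proof. by []. Qed.

(* If [p = alpha], the one-step recursion gives
   C(phi alpha; alpha) >= C(alpha; alpha) = M + delta * C(phi alpha; alpha). *)
Lemma MPE_stage_max (R : realType) (X : Type) (u1 u2 : X -> R)
    (delta lambda B M : R) phi z (alpha p : {i01 R}) :
  0 < delta < 1 -> 0 < lambda < 1 ->
  (forall x, `|u1 x| <= B) -> (forall x, `|u2 x| <= B) ->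
  stationary_MPE u1 u2 delta lambda phi z ->
  (forall beta, stage u1 u2 lambda z alpha beta <= M) ->
  stage u1 u2 lambda z alpha p = M -> p = alpha \/ phi p = p ->
  forall k, stage u1 u2 lambda z alpha (iter k phi (phi alpha)) = M.
Proof.
move=> hd hl B1 B2 mpe sM pM palpha.
have sB b k := stage_bounded z alpha (iter k phi b) hl B1 B2.
apply: (discounted_max hd (sB _) (fun k => sM _)).
have [_ /(_ p)] := mpe alpha; rewrite !continuationE.
case: palpha => [pa|php].
- subst p; rewrite {1}(discounted_recl hd (sB alpha)) /=.
  under eq_fun do rewrite -iterS iterSr.
  case/andP: hd => _; rewrite -subr_gt0 => d1.
  by rewrite ler_pdivrMr// pM; lra.
(* Moving to the fixed point [p] yields [M] in every period, hence exactly [M / (1 - delta)]. *)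
- apply: le_trans; rewrite le_eqVlt -(discounted_cst M hd); apply/orP; left.
  apply/eqP; congr (discounted _ _); apply/funext => k.
  have -> : iter k phi p = p by elim: k => //= k ->.
  by rewrite pM.
Qed.

(** After one move [phi] stays put, so the prescribed choice earns the largest stage payoff in every
    period and beats each deviation term by term. *)
Lemma absorbing_MPE (R : realType) (X : Type) (u1 u2 : X -> R)
    (delta lambda B : R) (phi : {i01 R} -> {i01 R}) z :
  0 < delta < 1 -> 0 < lambda < 1 ->
  (forall x, `|u1 x| <= B) -> (forall x, `|u2 x| <= B) ->
  (forall alpha, opt_actions u1 u2 alpha (z alpha)) ->
  (forall alpha, phi (phi alpha) = phi alpha) ->
  (forall alpha beta, stage u1 u2 lambda z alpha beta <=
                      stage u1 u2 lambda z alpha (phi alpha)) ->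
  stationary_MPE u1 u2 delta lambda phi z.
Proof.
move=> hd hl B1 B2 opt phiK sM alpha; split=> // beta; rewrite !continuationE.
have -> : (fun k => stage u1 u2 lambda z alpha (iter k phi (phi alpha))) =
    fun=> stage u1 u2 lambda z alpha (phi alpha).
  by apply/funext => k; congr stage; elim: k => //= k ->.
rewrite discounted_cst//; apply: (discounted_le hd) => k //.
exact: stage_bounded.
Qed.

(** * The environment with three actions *)

Lemma pay1_bounded (R : realType) (x : action) : `|pay1 R x| <= 3.
Proof. by case: x; rewrite ler_norml; apply/andP; split => /=; lra. Qed.

Lemma pay2_bounded (R : realType) (x : action) : `|pay2 R x| <= 3.
Proof. by case: x; rewrite ler_norml; apply/andP; split => /=; lra. Qed.

(** The payoffs of [act_c], [act_a], [act_b] at [alpha] are 0, [4 * alpha - 3] and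
    [1 - 4 * alpha]. *)
Lemma opt_actionsE (R : realType) (alpha : {i01 R}) (x : action) :
  opt_actions (@pay1 R) (@pay2 R) alpha x <->
  match x with
  | act_c => 1 / 4 <= alpha%:num <= 3 / 4
  | act_a => 3 / 4 <= alpha%:num
  | act_b => alpha%:num <= 1 / 4
  end.
Proof.
rewrite /opt_actions /payoff /=; split.
- move=> h; move: (h act_a) (h act_b) (h act_c).
  by case: x {h} => /= ? ? ?; [apply/andP; split| |]; lra.
- by case: x => [/=/andP[? ?]|/= ?|/= ?] [] /=; lra.
Qed.

Lemma stageE (R : realType) (lambda : R) (z : {i01 R} -> action) alpha beta :
  stage (@pay1 R) (@pay2 R) lambda z alpha beta =
  match z beta with
  | act_c => 0
  | act_a => (1 - lambda) * (4 * beta%:num - 3) + lambda * (4 * alpha%:num - 3)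
  | act_b => (1 - lambda) * (1 - 4 * beta%:num) + lambda * (1 - 4 * alpha%:num)
  end.
Proof. by rewrite /stage /payoff; case: (z beta) => /=; ring. Qed.

(** * An explicit family of equilibria *)

Definition truthful_action (R : realType) (alpha : {i01 R}) : action :=
  if alpha%:num < 1 / 4 then act_b
  else if alpha%:num <= 3 / 4 then act_c else act_a.

Lemma truthful_action_opt (R : realType) (alpha : {i01 R}) :
  opt_actions (@pay1 R) (@pay2 R) alpha (truthful_action alpha).
Proof.
apply/opt_actionsE; rewrite /truthful_action.
by case: ltP => [/ltW//|?]; case: leP => [?|/ltW//]; apply/andP.
Qed.

(* [gain1] and [gain0] are the per-period payoffs, seen from [alpha], of
   adopting the pure worldviews, the moderate one giving 0; [tie] lets a pure
   worldview win a tie against the moderate one. *)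
Definition absorbing_choice (R : realType) (lambda : R) (tie : bool)
    (alpha : {i01 R}) : {i01 R} :=
  let gain1 := 1 - 4 * lambda * (1 - alpha%:num) in
  let gain0 := 1 - 4 * lambda * alpha%:num in
  if gain0 <= gain1 then
    if 0 < gain1 ?<= if tie then 1%:i01 else mid_worldview R
  else
    if 0 < gain0 ?<= if tie then 0%:i01 else mid_worldview R.

(** The definition tests only the larger gain; [ChooseMid] records that the smaller one fails the
    test as well. *)
Variant absorbing_choice_spec (R : realType) (lambda : R) (tie : bool)
    (alpha : {i01 R}) : {i01 R} -> Type :=
| ChooseOne of 1 - 4 * lambda * alpha%:num <= 1 - 4 * lambda * (1 - alpha%:num)
    & 0 < 1 - 4 * lambda * (1 - alpha%:num) ?<= if tie :
    absorbing_choice_spec lambda tie alpha 1%:i01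
| ChooseZero of 1 - 4 * lambda * (1 - alpha%:num) < 1 - 4 * lambda * alpha%:num
    & 0 < 1 - 4 * lambda * alpha%:num ?<= if tie :
    absorbing_choice_spec lambda tie alpha 0%:i01
| ChooseMid of 1 - 4 * lambda * alpha%:num < 0 ?<= if ~~ tie
    & 1 - 4 * lambda * (1 - alpha%:num) < 0 ?<= if ~~ tie :
    absorbing_choice_spec lambda tie alpha (mid_worldview R).

Lemma absorbing_choiceP (R : realType) (lambda : R) (tie : bool) alpha :
  absorbing_choice_spec lambda tie alpha (absorbing_choice lambda tie alpha).
Proof.
rewrite /absorbing_choice.
case: ifP => [h10|/negbT]; last rewrite -ltNge => h10.
- case: ifP => [h|/negbT]; first by constructor.
  rewrite -lteifNE => h.
  by constructor=> //; case: tie h => /= h; [exact: le_lt_trans h|exact: le_trans h].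
- case: ifP => [h|/negbT]; first by constructor.
  rewrite -lteifNE => h.
  by constructor=> //; case: tie h => /= h; [exact: lt_trans h|exact: le_trans (ltW h10) h].
Qed.

(** The two gains add up to [2 - 4 * lambda], so they cannot both fail the test unless
    [1 - 2 * lambda] does. *)
Lemma absorbing_choice_eq_mid (R : realType) (lambda : R) (tie : bool) alpha :
  absorbing_choice lambda tie alpha = mid_worldview R ->
  1 - 2 * lambda < 0 ?<= if ~~ tie.
Proof.
case: absorbing_choiceP => [_ _|_ _|].
- by move/(congr1 (fun x : {i01 R} => x%:num)) => /=; lra.
- by move/(congr1 (fun x : {i01 R} => x%:num)) => /=; lra.
- by case: tie => /=; lra.
Qed.

(** At 1/2 both gains equal [1 - 2 * lambda]. *)
Lemma absorbing_choice_half (R : realType) (lambda : R) (tie : bool) :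
  1 - 2 * lambda < 0 ?<= if ~~ tie ->
  absorbing_choice lambda tie (mid_worldview R) = mid_worldview R.
Proof.
by case: absorbing_choiceP => //;
  case: tie => /= ? ? ?; exfalso; lra.
Qed.

Lemma absorbing_choice_is_MPE (R : realType) (delta lambda : R) (tie : bool) :
  0 < delta < 1 -> 0 < lambda < 1 ->
  is_MPE delta lambda (absorbing_choice lambda tie) (@truthful_action R).
Proof.
move=> hd hl; have /andP[l0 l1] := hl.
apply: (absorbing_MPE hd hl (@pay1_bounded R) (@pay2_bounded R)) => [a|a|a b].
- exact: truthful_action_opt.
(* Each value is a fixed point: a pure worldview has gain 1 from itself and [1 - 4 * lambda] from
   the other, and 1/2 is fixed whenever it is chosen anywhere. *)
- case E : (absorbing_choice lambda tie a) / absorbing_choiceP => [_ _|_ _|_ _].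
  + by case: absorbing_choiceP => //; case: tie {E} => /= ? ?; exfalso; lra.
  + by case: absorbing_choiceP => //; case: tie {E} => /= ? ?; exfalso; lra.
  + exact/absorbing_choice_half/(absorbing_choice_eq_mid E).
(* The stage payoff increases in [beta] under [act_a] and decreases under [act_b], so it is at most
   gain 1, gain 0 or 0 according to the action; these are attained at 1, 0 and 1/2. *)
- rewrite !stageE /truthful_action.
  have [b0 b1] : 0 <= b%:num /\ b%:num <= 1 by split.
  case: absorbing_choiceP => /=; case: tie => /=; do !case: ifP => /=; nra.
Qed.

(** * Distance to the pure worldviews and behaviour at them *)

Lemma dist_pure_ge (R : realType) (alpha : {i01 R}) (r : R) :
  r <= alpha%:num -> r <= 1 - alpha%:num ->
  r <= dist_set pure_worldviews alpha.
Proof.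
move=> r0 r1; apply: lb_le_inf.
  by exists `|alpha%:num - (0%:i01 : {i01 R})%:num|; exists 0%:i01 => //; left.
move=> _ [_ [->|->] <-] /=; first by rewrite subr0 ger0_norm.
by rewrite distrC ger0_norm// subr_ge0.
Qed.

Lemma i01_eq1 (R : realType) (beta : {i01 R}) : 1 <= beta%:num -> beta = 1%:i01.
Proof.
move=> b1; have b01 : beta%:num <= 1 by [].
by apply/val_inj/le_anti; rewrite /= b01.
Qed.

Lemma i01_eq0 (R : realType) (beta : {i01 R}) : beta%:num <= 0 -> beta = 0%:i01.
Proof.
move=> b0; have b01 : 0 <= beta%:num by [].
by apply/val_inj/le_anti; rewrite /= b0.
Qed.

(** Only [act_a] can yield 1 here: [act_c] gives 0 and [act_b] at most [1 - 4 * lambda]. Under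
    [act_a] the weight [1 - lambda > 0] forces [beta] to be 1. *)
Lemma stage_at_one (R : realType) (lambda : R) z (beta : {i01 R}) :
  0 < lambda < 1 ->
  stage (@pay1 R) (@pay2 R) lambda z 1%:i01 beta <= 1 /\
  (stage (@pay1 R) (@pay2 R) lambda z 1%:i01 beta = 1 -> beta = 1%:i01).
Proof.
move=> /andP[l0 l1]; have b0 : 0 <= beta%:num by [].
have b1 : beta%:num <= 1 by [].
by rewrite stageE; case: (z beta) => /=; split=> [|e];
  [nra|apply: i01_eq1; nra|nra|apply: i01_eq1; nra|nra|apply: i01_eq1; nra].
Qed.

Lemma stage_at_zero (R : realType) (lambda : R) z (beta : {i01 R}) :
  0 < lambda < 1 ->
  stage (@pay1 R) (@pay2 R) lambda z 0%:i01 beta <= 1 /\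
  (stage (@pay1 R) (@pay2 R) lambda z 0%:i01 beta = 1 -> beta = 0%:i01).
Proof.
move=> /andP[l0 l1]; have b0 : 0 <= beta%:num by [].
have b1 : beta%:num <= 1 by [].
by rewrite stageE; case: (z beta) => /=; split=> [|e];
  [nra|apply: i01_eq0; nra|nra|apply: i01_eq0; nra|nra|apply: i01_eq0; nra].
Qed.

Lemma MPE_pure_fixed (R : realType) (delta lambda : R) phi z :
  0 < delta < 1 -> 0 < lambda < 1 -> is_MPE delta lambda phi z ->
  [/\ phi 1%:i01 = 1%:i01, z 1%:i01 = act_a, phi 0%:i01 = 0%:i01 &
      z 0%:i01 = act_b].
Proof.
move=> hd hl mpe; have /andP[l0 l1] := hl.
have z1 : z 1%:i01 = act_a.
  by have [/opt_actionsE + _] := mpe 1%:i01; case: (z _) => //= [/andP[? ?]|?]; exfalso; lra.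
have z0 : z 0%:i01 = act_b.
  by have [/opt_actionsE + _] := mpe 0%:i01; case: (z _) => //= [/andP[? ?]|?]; exfalso; lra.
have smax := MPE_stage_max hd hl (@pay1_bounded R) (@pay2_bounded R) mpe.
split=> //.
- apply: (stage_at_one z _ hl).2.
  (* Period [k = 0] of the equilibrium path is [phi 1] itself. *)
  apply: (smax _ _ 1%:i01 _ _ _ 0%N) => [b||]; first exact: (stage_at_one z b hl).1.
  + by rewrite stageE z1 /=; lra.
  + by left.
- apply: (stage_at_zero z _ hl).2.
  apply: (smax _ _ 0%:i01 _ _ _ 0%N) => [b||]; first exact: (stage_at_zero z b hl).1.
  + by rewrite stageE z0 /=; lra.
  + by left.
Qed.

(** * The three regimes of [lambda] *)

Theorem theorem1 (R : realType) (delta lambda : R)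
    (hdelta : 0 < delta < 1) (hlambda : 0 < lambda < 1) :
  (exists phi z, is_MPE delta lambda phi z) /\
  (lambda < 1 / 2 ->
    forall phi z, is_MPE delta lambda phi z ->
      pure_worldviews (worldview_path phi (mid_worldview R) 1) /\
      forall t : nat, (1 <= t)%N ->
        worldview_path phi (mid_worldview R) t = worldview_path phi (mid_worldview R) 1) /\
  (lambda = 1 / 2 ->
    (exists phi z, is_MPE delta lambda phi z /\
       converges_to_pure (worldview_path phi (mid_worldview R))) /\
    (exists phi z, is_MPE delta lambda phi z /\
       ~ converges_to_pure (worldview_path phi (mid_worldview R))) /\
    (forall phi z, is_MPE delta lambda phi z ->
       forall t : nat, (1 <= t)%N ->
         ([set (beta, act_c) | beta in [set` `[(1 / 4 : R), 3 / 4]]]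
            `|` [set (1, act_a); (0, act_b)])
         ((worldview_path phi (mid_worldview R) t)%:num,
          action_path phi z (mid_worldview R) t))) /\
  (1 / 2 < lambda ->
    forall phi z, is_MPE delta lambda phi z ->
      (forall t : nat,
         action_path phi z (mid_worldview R) t = act_c /\
         1 / 4 <= (worldview_path phi (mid_worldview R) t)%:num <= 3 / 4) /\
      (forall t : nat,
         1 / 4 <= dist_set pure_worldviews (worldview_path phi (mid_worldview R) t)) /\
      ~ (dist_set pure_worldviews (worldview_path phi (mid_worldview R) t)
           @[t --> \oo] --> (0 : R))).
Proof.
have mpeP := absorbing_choice_is_MPE _ hdelta hlambda.
have /andP[l0 l1] := hlambda.
pose h := mid_worldview R; have hE : h%:num = 1 / 2 :> R by [].
have smax phi z (mpe : is_MPE delta lambda phi z) M p :=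
  @MPE_stage_max _ _ _ _ _ _ _ M _ _ h p hdelta hlambda (@pay1_bounded R) (@pay2_bounded R) mpe.
have opt phi z (mpe : is_MPE delta lambda phi z) b :=
  (opt_actionsE b (z b)).1 (mpe b).1.
have b01 (b : {i01 R}) : 0 <= b%:num /\ b%:num <= 1 by split.
split; first by do 2 eexists; exact: (mpeP true).
split=> [lt_half phi z mpe|].
  have [p1 z1 p0 z0] := MPE_pure_fixed hdelta hlambda mpe.
  have pure1 : pure_worldviews (phi h).
    have : stage (@pay1 R) (@pay2 R) lambda z h (phi h) = 1 - 2 * lambda.
      apply: (smax _ _ mpe _ 1%:i01 _ _ _ 0%N) => [b||]; last by right.
        have [? ?] := b01 b.
        by rewrite stageE hE; case: (z b) => /=; nra.
      by rewrite stageE z1 hE /=; lra.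
    have [? ?] := b01 (phi h).
    (* [act_c] yields 0, below [1 - 2 * lambda]; the other two actions reach this value only at an
       endpoint. *)
    rewrite stageE hE; case: (z _) => /= e; first by lra.
      by right; apply: i01_eq1; nra.
    by left; apply: i01_eq0; nra.
  split=> // -[//|t] _; rewrite /worldview_path iterSr /=.
  by case: pure1 => ->; elim: t => //= t ->.
split=> [eq_half|gt_half].
  split; last split.
  - exists (absorbing_choice lambda true), (@truthful_action R); split=> //.
    exists 1%:i01; first by right.
    rewrite -(cvg_shiftS (fun t => (worldview_path _ _ t)%:num)).
    have -> : (fun t => (worldview_path (absorbing_choice lambda true)
        (mid_worldview R) t.+1)%:num) = fun=> (1%:i01 : {i01 R})%:num.
      apply/funext => t; rewrite /worldview_path iterSr; congr (_%:num).
      (* Both gains are 0 at 1/2; [tie] accepts 0, and the test between equal gains selects 1. *)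
      have -> : absorbing_choice lambda true (mid_worldview R) = 1%:i01.
        by case: absorbing_choiceP => //= ? ?; exfalso; lra.
      elim: t => //= t ->.
      by case: absorbing_choiceP => //= ? ?; exfalso; lra.
    exact: cvg_cst.
  - exists (absorbing_choice lambda false), (@truthful_action R); split=> //.
    have -> : worldview_path (absorbing_choice lambda false) (mid_worldview R) =
        fun=> mid_worldview R.
      apply/funext; elim=> //= t; rewrite /worldview_path /= => ->.
      by apply: absorbing_choice_half => /=; lra.
    move=> [p pp] /(cvg_lim (@Rhausdorff R)).
    by rewrite lim_cst//; case: pp => -> /=; lra.
  - move=> phi z mpe [//|t] _.
    have [p1 z1 p0 z0] := MPE_pure_fixed hdelta hlambda mpe.
    rewrite /action_path /worldview_path iterSr; set b := iter _ _ _.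
    (* At [lambda = 1/2] the maximum is 0: [act_c] always attains it, [act_a] only at 1 and [act_b]
       only at 0. *)
    have : stage (@pay1 R) (@pay2 R) lambda z h b = 0.
      apply: (smax _ _ mpe _ 1%:i01) => [c||]; last by right.
        have [? ?] := b01 c.
        by rewrite stageE hE eq_half; case: (z c) => /=; lra.
      by rewrite stageE z1 hE /=; lra.
    have [? ?] := b01 b.
    have := opt _ _ mpe b; rewrite stageE hE eq_half.
    case: (z b) => /= bI e.
    + by left; exists b%:num => //=; rewrite in_itv.
    + by right; left; congr pair; lra.
    + by right; right; congr pair; lra.
move=> phi z mpe.
have zh : z h = act_c by have := opt _ _ mpe h; rewrite hE; case: (z h) => //= ?; exfalso; lra.
have main t : action_path phi z h t = act_c /\
    1 / 4 <= (worldview_path phi h t)%:num <= 3 / 4.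
  suff zc : z (worldview_path phi h t) = act_c.
    by split=> //; have := opt _ _ mpe (worldview_path phi h t); rewrite zc.
  case: t => // t; rewrite /worldview_path iterSr; set b := iter _ _ _.
  (* The maximum 0 is attained at [h] itself, which need not be fixed by [phi]; [act_a] and [act_b]
     yield at most [1 - 2 * lambda < 0]. *)
  have : stage (@pay1 R) (@pay2 R) lambda z h b = 0.
    apply: (smax _ _ mpe _ h) => [c||]; last by left.
      have [? ?] := b01 c.
      by rewrite stageE hE; case: (z c) => /=; nra.
    by rewrite stageE zh.
  have [? ?] := b01 b.
  by rewrite stageE hE; case: (z b) => //= e; exfalso; nra.
have far t : 1 / 4 <= dist_set pure_worldviews (worldview_path phi h t).
  by have [_ /andP[? ?]] := main t; apply: dist_pure_ge; lra.
split=> //; split=> // cv0.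
have : 1 / 4 <= 0 :> R.
  rewrite -(cvg_lim (@Rhausdorff R) cv0); apply: limr_ge; last exact: nearW.
  by apply/cvg_ex; exists 0.
lra.
Qed.
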